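(* Assume $F\subseteq\mathbb{R}^{\ell}$ is a nonempty closed convex set, $a\in\mathbb{R}^{\ell}$, $H$ is a proper closed convex subset of $\mathbb{R}^{\ell}$, and $k\in\operatorname{int}0^+H$, where $k\in 0^+H\setminus\{0\}$. (a) If $M_{F,a,H,k}=\emptyset$ or if $M_{F,a,H,k}$ is not bounded, then, for each $b\in\mathbb{R}^{\ell}$ and $k^0\in 0^+H\setminus(-0^+H)$, $M_{F,b,H,k^0}=\emptyset$ or $0^+M_{F,b,H,k^0}\neq\{0\}$. (b) If $M_{F,a,H,k}$ is nonempty and bounded, then, for each $b\in\mathbb{R}^{\ell}$ and $k^0\in\operatorname{int}0^+H$, $M_{F,b,H,k^0}$ is nonempty and compact.
   Context: $\ell\ge 1$ is an integer. For $A\subseteq\mathbb{R}^{\ell}$, the recession cone is $0^+A:=\{u\in\mathbb{R}^{\ell}\mid A+\mathbb{R}_+u\subseteq A\}$, where $\mathbb{R}_+=[0,\infty)$. $\operatorname{int}$ denotes the topological interior. A proper subset of $\mathbb{R}^{\ell}$ is a nonempty subset different from $\mathbb{R}^{\ell}$. For $b\in\mathbb{R}^{\ell}$ and $k^0\in 0^+H\setminus\{0\}$, $(P_{F,b,H,k^0})$ is the problem of minimizing $t$ over all pairs $(y,t)\in F\times\mathbb{R}$ with $y\in b-H+tk^0$ (the feasible solutions). $M_{F,b,H,k^0}$ is the set of its optimal solutions $y$, i.e. of all $y\in F$ for which there is $t\in\mathbb{R}$ such that $(y,t)$ is feasible and $t\le s$ for every feasible $(z,s)$. *)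

(* Defs.v *)
From mathcomp Require Import all_boot all_order all_algebra.
From mathcomp Require Import all_classical all_reals all_analysis.

Set Implicit Arguments.
Unset Strict Implicit.
Unset Printing Implicit Defensive.

Import Order.TTheory GRing.Theory Num.Theory.
Import numFieldNormedType.Exports.

Local Open Scope classical_set_scope.
Local Open Scope ring_scope.

(* [R^l] is ['rV[R]_l] with the topology of the max norm. *)

Definition recession_cone (R : realType) (l : nat) (A : set 'rV[R]_l) :
    set 'rV[R]_l :=
  [set u | [set a + t *: u | a in A & t in [set t : R | 0 <= t]] `<=` A].

Definition proper_subset (T : Type) (A : set T) : Prop :=
  A !=set0 /\ A <> setT.

(* The problem is meant for [k0 \in 0^+H \ {0}]; this and the next definition
   are total in [k0], and the restriction is imposed where they are used. *)
Definition feasible (R : realType) (l : nat)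
    (F : set 'rV[R]_l) (b : 'rV[R]_l) (H : set 'rV[R]_l) (k0 : 'rV[R]_l) :
    set ('rV[R]_l * R) :=
  [set yt | F yt.1 /\ [set b - h + yt.2 *: k0 | h in H] yt.1].

Definition optimal_set (R : realType) (l : nat)
    (F : set 'rV[R]_l) (b : 'rV[R]_l) (H : set 'rV[R]_l) (k0 : 'rV[R]_l) :
    set 'rV[R]_l :=
  [set y | F y /\ exists t : R, feasible F b H k0 (y, t) /\
     forall (z : 'rV[R]_l) (s : R), feasible F b H k0 (z, s) -> t <= s].

(* Main.v *)
(* Both parts reduce to one condition that involves neither b nor k0:
   0^+F and -0^+H meet only in 0.
   If it holds and k0 is interior to 0^+H, every level set
   F `&` (b - H + t k0) is bounded, since an unbounded closed convex set contains
   a ray and a ray in F (in H) gives a recession direction of F (of H); compactness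
   of the nested level sets then yields an optimum, the levels being bounded below
   because an interior direction k0 with h + t k0 \in H for all t would force H to
   be the whole space.
   If it fails, a nonzero common direction belongs to 0^+M for every optimal set M,
   so a nonempty M is unbounded. *)
Require Import Defs.
From mathcomp Require Import all_boot all_order all_algebra.
From mathcomp Require Import all_classical all_reals all_analysis.
From mathcomp Require Import ring.

Set Implicit Arguments.
Unset Strict Implicit.
Unset Printing Implicit Defensive.

Import Order.TTheory GRing.Theory Num.Theory.
Import numFieldNormedType.Exports.

Local Open Scope classical_set_scope.
Local Open Scope ring_scope.

(** * Convexity, rays and recession directions *)

Lemma convex_setP (R : realType) (V : lmodType R) (A : set V) :
  convex_set (A : set (convex_lmodType V)) <->
  forall x y (t : R), 0 <= t <= 1 -> A x -> A y -> A (t *: x + (1 - t) *: y).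
Proof.
split=> [cA x y t /andP[t0 t1] Ax Ay|cA x y p].
  by have := cA x y (Itv01 t0 t1); rewrite !inE; apply.
by rewrite !inE => Ax Ay; apply: cA => //; apply/andP.
Qed.

Lemma recession_coneP (R : realType) (l : nat) (A : set 'rV[R]_l) (u : 'rV[R]_l) :
  recession_cone A u <-> forall x (s : R), A x -> 0 <= s -> A (x + s *: u).
Proof.
split=> [Cu x s Ax s0|Cu _ [x Ax [s s0 <-]]]; last exact: Cu.
by apply: Cu; exists x => //; exists s.
Qed.

(** By directedness the traces [B i]&[K] form a base of a proper filter; a cluster point of it in
    [K] lies in every closed [B i]. *)
Lemma directed_compact_bigcap (T : topologicalType) (I : Type) (D : set I)
    (B : I -> set T) (K : set T) :
  compact K -> D !=set0 ->
  (forall i j, D i -> D j -> exists2 m, D m & B m `<=` B i `&` B j) ->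
  (forall i, D i -> closed (B i)) -> (forall i, D i -> B i `&` K !=set0) ->
  exists2 x, K x & forall i, D i -> B i x.
Proof.
move=> cK [i0 Di0] dir clB ne.
pose E i := B i `&` K.
have FF : Filter (filter_from D E).
  apply: filter_from_filter; first by exists i0.
  move=> i j Di Dj; have [m Dm Bm] := dir i j Di Dj.
  by exists m => // x [/Bm[? ?] ?].
have PF : ProperFilter (filter_from D E) by apply: filter_from_proper.
have [|x [Kx clx]] := cK _ PF; first by exists i0 => // x [].
exists x => // i Di; apply: clB => // U Ux.
have [|y [[By _] Uy]] := clx (E i) U _ Ux; first by exists i.
by exists y.
Qed.

Lemma unbounded_far (R : realType) (V : normedModType R) (A : set V) (x : V) (r : R) :
  ~ bounded_set A -> exists2 y, A y & r <= `|y - x|.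
Proof.
move=> nbA; apply: contrapT => far; apply: nbA.
exists (r + `|x|); split; first exact: num_real.
move=> M ltM y Ay /=; rewrite -(subrK x y) (le_trans (ler_normD _ _))//.
rewrite (le_trans _ (ltW ltM))// lerD2r leNgt; apply/negP => /ltW ry.
by apply: far; exists y.
Qed.

Lemma closed_along_ray (R : realType) (V : normedModType R) (A : set V) (x : V) (s : R) :
  closed A -> closed [set u | A (x + s *: u)].
Proof.
move=> clA; apply: (@preimage_closed _ _ (fun u => x + s *: u)) => // u _.
by apply: cvgD; [exact: cvg_cst|apply: cvgZ; [exact: cvg_cst|exact: cvg_id]].
Qed.

(* The directions u of the unit sphere with x + s u \in A decrease with s, by
   convexity, so a direction common to all s exists by compactness. *)
Lemma unbounded_ray (R : realType) (l : nat) (A : set 'rV[R]_l) (x : 'rV[R]_l) :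
  closed A -> convex_set (A : set (convex_lmodType 'rV[R]_l)) -> A x ->
  ~ bounded_set A ->
  exists2 u, u != 0 & forall s : R, 0 <= s -> A (x + s *: u).
Proof.
move=> clA cvA Ax nbA.
have cS : compact [set u : 'rV[R]_l | `|u| = 1].
  apply: bounded_closed_compact.
    by exists 1; split=> // M ltM u /= ->; exact: ltW.
  apply: (@preimage_closed _ _ (fun u : 'rV[R]_l => `|u|) [set 1]).
    by move=> u _; exact: norm_continuous.
  exact: closed_eq.
have shrink u s s' : 0 <= s <= s' -> A (x + s' *: u) -> A (x + s *: u).
  move=> /andP[s0 ss'] As'.
  have [s'0|s'0] := eqVneq s' 0.
    by have -> : s = s' by apply/eqP; rewrite eq_le ss' s'0.
  have s'p : 0 < s' by rewrite lt_def s'0 (le_trans s0).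
  have -> : x + s *: u = (s / s') *: (x + s' *: u) + (1 - s / s') *: x.
    by rewrite scalerDr scalerA divfK// addrAC -scalerDl [s / s' + _]addrC subrK scale1r.
  apply: ((convex_setP A).1 cvA) => //; rewrite divr_ge0 ?(ltW s'p)//=.
  by rewrite ler_pdivrMr// mul1r.
have [||||u /= u1 uA] := @directed_compact_bigcap 'rV[R]_l R [set s | 0 <= s]
    (fun s => [set u | A (x + s *: u)]) _ cS.
- by exists 0 => /=.
- move=> s s' /= s0 s'0; exists (Num.max s s'); first by rewrite /= le_max s0.
  by move=> u /= Au; split; apply: shrink Au; rewrite ?s0 ?s'0 le_max lexx ?orbT.
- by move=> s _; exact: closed_along_ray.
(* The extra 1 keeps [y - x] nonzero even at [s = 0], so it can be normalized. *)
- move=> s /= s0; have [y Ay sy] := unbounded_far x (s + 1) nbA.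
  have ypos : 0 < `|y - x| by apply: lt_le_trans sy; rewrite ltr_wpDl.
  exists (`|y - x|^-1 *: (y - x)); split=> /=; last first.
    by rewrite normrZ ger0_norm ?invr_ge0// mulVf// gt_eqF.
  apply: (@shrink _ _ `|y - x|).
    by rewrite s0 (le_trans _ sy)// lerDl.
  by rewrite /= scalerA divff ?gt_eqF// scale1r addrC subrK.
exists u => //; apply/eqP => u0; move: u1; rewrite u0 normr0 => /eqP.
by rewrite eq_sym oner_eq0.
Qed.

(** Segments from any [y] in [A] to ever farther points of the ray turn towards [u]; closedness
    keeps the limit in [A]. *)
Lemma ray_recession (R : realType) (l : nat) (A : set 'rV[R]_l) (x u : 'rV[R]_l) :
  closed A -> convex_set (A : set (convex_lmodType 'rV[R]_l)) ->
  (forall s : R, 0 <= s -> A (x + s *: u)) -> recession_cone A u.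
Proof.
move=> clA cvA ray; apply/recession_coneP => y s Ay s0.
(* f n is the point of the segment from y to x + n.+1 s u at ratio 1 / n.+1. *)
pose f n := y + s *: u + n.+1%:R^-1 *: (x - y) : 'rV[R]_l.
have fA n : A (f n).
  have -> : f n = n.+1%:R^-1 *: (x + (n.+1%:R * s) *: u)
                  + (1 - n.+1%:R^-1) *: y.
    rewrite /f scalerBr scalerDr scalerA mulKf ?pnatr_eq0// scalerBl scale1r.
    by rewrite [y + _]addrC addrACA [s *: u + _]addrC.
  apply: ((convex_setP A).1 cvA) => //; last by apply: ray; rewrite mulr_ge0.
  by rewrite invr_ge0 ler0n /= invf_le1 ?ltr0n// ler1n.
apply: (@closed_cvg _ _ \oo _ f A clA); first exact: nearW.
rewrite -[X in _ --> X]addr0 -(scale0r (x - y)).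
apply: cvgD; first exact: cvg_cst.
by apply: cvgZ; [exact: cvg_harmonic|exact: cvg_cst].
Qed.

Lemma bounded_recession0 (R : realType) (l : nat) (A : set 'rV[R]_l) (x u : 'rV[R]_l) :
  bounded_set A -> A x -> recession_cone A u -> u = 0.
Proof.
move=> [M [_ bA]] Ax /recession_coneP Cu; apply/eqP/negPn/negP => u0.
have up : 0 < `|u| by rewrite normr_gt0.
pose r := `|M| + 1 + `|x|.
have r0 : 0 <= r by rewrite /r !addr_ge0.
(* The multiple of [u] has norm [r + 1], so the point has norm at least [|M| + 2]. *)
have : `|x + (r / `|u| + `|u|^-1) *: u| <= `|M| + 1.
  apply: (bA (`|M| + 1)); last by apply: Cu; rewrite // addr_ge0 ?divr_ge0 ?invr_ge0.
  by rewrite (le_lt_trans (ler_norm M))// ltrDl.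
apply/negP; rewrite -ltNge.
rewrite [x + _]addrC; apply: lt_le_trans (lerB_normD _ _).
rewrite normrZ ger0_norm ?addr_ge0 ?divr_ge0 ?invr_ge0//.
by rewrite mulrDl divfK ?gt_eqF// mulVf ?gt_eqF// /r ltrBrDr ltrDl.
Qed.

(** For large [r] the vector [k + v / r] is still in the cone, hence so is its multiple [r k + v];
    [r] does not depend on [h]. *)
Lemma interior_recession_absorb (R : realType) (l : nat) (H : set 'rV[R]_l)
    (k v : 'rV[R]_l) : (recession_cone H)° k ->
  exists2 r, 0 < r & forall h, H h -> H (h + r *: k + v).
Proof.
move=> /nbhs_ballP[e /= e0 bH].
pose r := (`|v| + 1) / e.
have r0 : 0 < r by rewrite divr_gt0// ltr_wpDl.
exists r => // h Hh.
have -> : h + r *: k + v = h + r *: (k + r^-1 *: v).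
  by rewrite scalerDr scalerA divff ?gt_eqF// scale1r addrA.
have /recession_coneP : recession_cone H (k + r^-1 *: v).
  apply: bH; rewrite -ball_normE /= opprD addrA subrr add0r normrN normrZ.
  rewrite ger0_norm ?invr_ge0 ?(ltW r0)// mulrC ltr_pdivrMr//.
  by rewrite /r mulrC divfK ?gt_eqF// ltrDl.
by apply=> //; exact: ltW.
Qed.

(** * Level sets and the optimal set *)

Definition level (R : realType) (l : nat) (F : set 'rV[R]_l) (b : 'rV[R]_l)
    (H : set 'rV[R]_l) (k : 'rV[R]_l) (t : R) : set 'rV[R]_l :=
  [set y | F y /\ H (b - y + t *: k)].

Lemma feasibleE (R : realType) (l : nat) (F : set 'rV[R]_l) (b : 'rV[R]_l)
    (H : set 'rV[R]_l) (k : 'rV[R]_l) (y : 'rV[R]_l) (t : R) :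
  feasible F b H k (y, t) <-> level F b H k t y.
Proof.
split=> [[Fy [h Hh /= hy]]|[Fy Hy]]; split=> //=.
  suff -> : b - y + t *: k = h by [].
  by rewrite -hy opprD opprB addrA [b + _]addrC subrK addrNK.
exists (b - y + t *: k) => //.
by rewrite opprD opprB addrA [b + _]addrC subrK addrNK.
Qed.

(** Moving [y] along [u] moves [b - y + t *: k] along [- u] inside [H], so the same value [t] stays
    feasible. *)
Lemma optimal_set_recession (R : realType) (l : nat) (F : set 'rV[R]_l)
    (b : 'rV[R]_l) (H : set 'rV[R]_l) (k u : 'rV[R]_l) :
  recession_cone F u -> recession_cone H (- u) ->
  recession_cone (optimal_set F b H k) u.
Proof.
move=> /recession_coneP CF /recession_coneP CH; apply/recession_coneP.
move=> y s [Fy [t [/feasibleE[_ Hy] mint]]] s0; split; first exact: CF.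
exists t; split=> //; apply/feasibleE; split; first exact: CF.
have -> : b - (y + s *: u) + t *: k = b - y + t *: k + s *: - u.
  by rewrite scalerN opprD addrA [RHS]addrAC.
exact: CH.
Qed.

Section level.
Variables (R : realType) (l : nat) (F : set 'rV[R]_l) (H : set 'rV[R]_l).
Hypotheses (clF : closed F) (clH : closed H).
Hypothesis cvF : convex_set (F : set (convex_lmodType 'rV[R]_l)).
Hypothesis cvH : convex_set (H : set (convex_lmodType 'rV[R]_l)).

Lemma closed_level (b k : 'rV[R]_l) (t : R) : closed (level F b H k t).
Proof.
apply: closedI => //.
have := @closed_along_ray _ _ H (b + t *: k) (-1) clH.
by congr closed; apply/seteqP; split=> y /=; rewrite scaleN1r addrAC.
Qed.

Lemma convex_level (b k : 'rV[R]_l) (t : R) :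
  convex_set (level F b H k t : set (convex_lmodType 'rV[R]_l)).
Proof.
apply/convex_setP => x y p p01 [Fx Hx] [Fy Hy].
split; first exact: ((convex_setP F).1 cvF).
have := (convex_setP H).1 cvH _ _ _ p01 Hx Hy; congr H.
by apply/matrixP => i j; rewrite !mxE; ring.
Qed.

Lemma level_bounded (b k : 'rV[R]_l) (t : R) :
  (forall u, recession_cone F u -> recession_cone H (- u) -> u = 0) ->
  bounded_set (level F b H k t).
Proof.
move=> triv; apply: contrapT => nb.
have [y ly _] := unbounded_far 0 0 nb.
have [u /eqP u0 ray] := unbounded_ray (@closed_level b k t) (@convex_level b k t) ly nb.
apply: u0; apply: triv.
  by apply: (@ray_recession _ _ _ y) => // s /ray[].
apply: (@ray_recession _ _ _ (b - y + t *: k)) => // s /ray[_].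
by rewrite scalerN opprD addrA [X in H X]addrAC.
Qed.

(** The optimal set turns out to be the lowest nonempty level, at [inf T]. *)
Lemma optimal_set_compact (b k : 'rV[R]_l) :
  F !=set0 -> proper_subset H -> (recession_cone H)° k ->
  (forall u, recession_cone F u -> recession_cone H (- u) -> u = 0) ->
  optimal_set F b H k !=set0 /\ compact (optimal_set F b H k).
Proof.
move=> [y0 Fy0] [[h0 Hh0] HT] kint triv.
have /recession_coneP Ck : recession_cone H k by exact: interior_subset kint.
have cL t : compact (level F b H k t).
  by apply: bounded_closed_compact; [exact: level_bounded|exact: closed_level].
have monoL t s : t <= s -> level F b H k t `<=` level F b H k s.
  move=> ts y [Fy Hy]; split=> //.
  have -> : b - y + s *: k = b - y + t *: k + (s - t) *: k.
    by rewrite -[RHS]addrA -scalerDl [t + _]addrC subrK.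
  by apply: Ck; rewrite // subr_ge0.
pose T := [set t | level F b H k t !=set0].
have [t1 Tt1] : T !=set0.
  (* The shift takes [h0] to [b - y0], so [y0] is feasible at value [r]. *)
  have [r _ rH] := interior_recession_absorb (b - y0 - h0) kint.
  exists r, y0; split=> //; have := rH _ Hh0; congr H.
  by apply/matrixP => i j; rewrite !mxE; ring.
(* One point [z] common to all nonempty levels serves both to bound [T] below and to attain its
   infimum. *)
have [z _ zT] : exists2 z, level F b H k t1 z &
    forall t, T t -> level F b H k t z.
  apply: (@directed_compact_bigcap _ _ T (level F b H k)) => //.
  - by exists t1.
  - move=> s t Ts Tt; exists (Num.min s t); first by rewrite /Num.min; case: ifP.
    by move=> y Ly; split; apply: monoL Ly; rewrite ge_min lexx ?orbT.
  - by move=> t _; exact: closed_level.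
  - move=> t [y Ly]; case: Tt1 => y1 Ly1; have [tt1|t1t] := leP t t1.
      by exists y; split=> //; exact: monoL Ly.
    by exists y1; split=> //; apply: monoL Ly1; exact: ltW.
have lbT : has_lbound T.
  apply: contrapT => nlb; apply: HT; apply/seteqP; split=> // x _.
  (* Were [T] unbounded below, [b - z - r *: k] would lie in [H], and the shift would carry it to
     the arbitrary point [x]. *)
  have [r r0 rH] := interior_recession_absorb (x - (b - z)) kint.
  have [t Tt tr] : exists2 t, T t & t <= - r.
    apply: contrapT => nt; apply: nlb; exists (- r) => t Tt.
    by rewrite leNgt; apply/negP => /ltW ?; apply: nt; exists t.
  have [_ Hz] := monoL _ _ tr _ (zT _ Tt).
  have := rH _ Hz; congr H.
  by apply/matrixP => i j; rewrite !mxE; ring.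
(* The values [t] with [b - z + t *: k] in [H] form a closed set containing [T], hence also
   [inf T]. *)
have Linf : level F b H k (inf T) z.
  have clt : closed [set t | H (b - z + t *: k)].
    apply: (@preimage_closed _ _ (fun t : R => b - z + t *: k)) => // t _.
    by apply: cvgD; [exact: cvg_cst|apply: cvgZ; [exact: cvg_id|exact: cvg_cst]].
  split; first by have [] := zT _ Tt1.
  apply: clt => U /nbhs_ballP[e /= e0 eU].
  have [t Tt te] := inf_adherent e0 (conj (ex_intro _ t1 Tt1) lbT).
  exists t; split; first by have [] := zT _ Tt.
  apply: eU; rewrite -ball_normE /= distrC ger0_norm ?subr_ge0 ?ge_inf//.
  by rewrite ltrBlDl.
have -> : optimal_set F b H k = level F b H k (inf T).
  apply/seteqP; split=> [y [Fy [t [/feasibleE Ly mint]]]|y Ly].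
    by apply: monoL Ly; apply: mint; apply/feasibleE; exact: Linf.
  split; first by case: Ly.
  exists (inf T); split; first exact/feasibleE.
  by move=> y' s /feasibleE Ls; apply: ge_inf => //; exists y'.
by split; [exists z|exact: cL].
Qed.
End level.

Theorem proposition18 (R : realType) (l : nat) (hl : (1 <= l)%N)
    (F : set 'rV[R]_l) (a : 'rV[R]_l) (H : set 'rV[R]_l) (k : 'rV[R]_l)
    (F_nonempty : F !=set0) (F_closed : closed F)
    (F_convex : convex_set (F : set (convex_lmodType 'rV[R]_l)))
    (H_proper : proper_subset H) (H_closed : closed H)
    (H_convex : convex_set (H : set (convex_lmodType 'rV[R]_l)))
    (k_cone : (recession_cone H `\` [set 0]) k)
    (k_int : (recession_cone H)° k) :
  ((optimal_set F a H k = set0 \/ ~ bounded_set (optimal_set F a H k)) ->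
     forall b k0 : 'rV[R]_l,
       (recession_cone H `\` [set - u | u in recession_cone H]) k0 ->
       optimal_set F b H k0 = set0 \/
       recession_cone (optimal_set F b H k0) <> [set 0])
  /\
  ((optimal_set F a H k !=set0 /\ bounded_set (optimal_set F a H k)) ->
     forall b k0 : 'rV[R]_l,
       (recession_cone H)° k0 ->
       optimal_set F b H k0 !=set0 /\ compact (optimal_set F b H k0)).
Proof.
have compactM := optimal_set_compact F_closed H_closed F_convex H_convex.
split=> [badM b k0 _|[[y My] bM] b k0 k0_int].
  have [u [Fu Hu u0]] : exists u, [/\ recession_cone F u, recession_cone H (- u) & u <> 0].
    apply: contrapT => nou.
    have [[y My] cM] : optimal_set F a H k !=set0 /\ compact (optimal_set F a H k).
      apply: compactM => // u Fu Hu; apply: contrapT => u0.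
      by apply: nou; exists u.
    by case: badM => [M0|]; [rewrite M0 in My|apply; exact: compact_bounded].
  (* This alternative also covers an empty optimal set, whose recession cone is the whole space. *)
  right=> M0; apply: u0.
  have : recession_cone (optimal_set F b H k0) u by exact: optimal_set_recession.
  by rewrite M0.
(* A common direction would be a recession direction of the bounded nonempty set for [a] and [k],
   hence zero; this condition then serves every [b] and [k0]. *)
apply: compactM => // u Fu Hu.
by apply: (bounded_recession0 bM My); exact: optimal_set_recession.
Qed.
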